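(* Let $D>0$, let $(\mathcal X,\|\cdot\|)$ be a $(2,D)$-smooth separable Banach space, and let $f\in\mathcal M(\mathcal X)$ be such that $\sum_{j=1}^\infty\|d_j\|_\infty^2\le b_*^2$ for some $b_*>0$. Then for all $r\ge0$, $$\mathbf{Pr}(f^*\ge r)\le 2\exp\left\{-\frac{r^2}{2D^2b_*^2}\right\}.$$
   Context: A real Banach space $(\mathcal X,\|\cdot\|)$ is called $(2,D)$-smooth if $\|x+y\|^2+\|x-y\|^2\le 2\|x\|^2+2D^2\|y\|^2$ for all $x,y\in\mathcal X$. For a separable Banach space $\mathcal X$, $\mathcal M(\mathcal X)$ is the class of all martingales $f=(f_0,f_1,\ldots)$ of Bochner-integrable random vectors in $\mathcal X$ with $f_0\equiv 0$, defined on some probability space with respect to some filtration (both may depend on $f$). Put $d_j=f_j-f_{j-1}$ for $j\ge1$, $f^*=\sup_{j\ge0}\|f_j\|$; $\|d_j\|_\infty$ denotes the essential supremum of the real random variable $\|d_j\|$. *)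

(* Defs.v *)
From HB Require Import structures.
From mathcomp Require Import all_boot all_order all_algebra.
From mathcomp Require Import all_classical all_reals all_analysis ess_sup_inf.

Set Implicit Arguments.
Unset Strict Implicit.
Unset Printing Implicit Defensive.

Import Order.TTheory GRing.Theory Num.Theory.
Import numFieldNormedType.Exports.

Local Open Scope classical_set_scope.
Local Open Scope ring_scope.

Definition smooth2 (R : realType) (X : normedModType R) (D : R) : Prop :=
  forall x y : X,
    `|x + y| ^+ 2 + `|x - y| ^+ 2 <= 2 * `|x| ^+ 2 + 2 * D ^+ 2 * `|y| ^+ 2.

Definition separable (X : topologicalType) : Prop :=
  exists S : set X, countable S /\ dense S.

(* [G] is a system of events, in the applications a sub-sigma-algebra. *)
Definition borel_measurable (T : Type) (X : topologicalType) (G : set (set T))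
    (f : T -> X) : Prop :=
  forall B : set X, <<s (@open X) >> B -> G (f @^-1` B).

Section Bochner.
Context (d : measure_display) (T : measurableType d) (R : realType).
Context (P : probability T R) (X : completeNormedModType R).

Definition simple_vector (s : T -> X) : Prop :=
  finite_set (range s) /\ forall x : X, measurable (s @^-1` [set x]).

Definition simple_integral (A : set T) (s : T -> X) : X :=
  \sum_(x \in range s) fine (P (A `&` s @^-1` [set x])) *: x.

Definition simple_approx (A : set T) (f : T -> X) (s : nat -> T -> X) : Prop :=
  (forall n, simple_vector (s n)) /\
  (\int[P]_(w in A) (`|f w - s n w|)%:E)%E @[n --> \oo] --> (0 : \bar R).

Definition bochner_integrable (f : T -> X) : Prop :=
  borel_measurable measurable f /\ exists s, simple_approx setT f s.

(* The limit of the integrals of the simple approximations does not depend on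
   the approximating sequence; the value is 0 when no such limit exists. *)
Definition bochner_integral (A : set T) (f : T -> X) : X :=
  xget 0 [set m : X | exists s : nat -> T -> X,
    simple_approx A f s /\ simple_integral A (s n) @[n --> \oo] --> m].

(* [g] is a version of the conditional expectation of [f] given [G]. *)
Definition is_cond_expectation (G : set (set T)) (f g : T -> X) : Prop :=
  [/\ borel_measurable G g, bochner_integrable g &
      forall A, G A -> bochner_integral A g = bochner_integral A f].

Definition filtration (F : nat -> set (set T)) : Prop :=
  [/\ forall n, sigma_algebra setT (F n),
      forall n, F n `<=` measurable &
      forall m n, (m <= n)%N -> F m `<=` F n].

Definition martingale (F : nat -> set (set T)) (f : nat -> T -> X) : Prop :=
  [/\ filtration F,
      forall n, borel_measurable (F n) (f n),
      forall n, bochner_integrable (f n) &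
      forall n, is_cond_expectation (F n) (f n.+1) (f n)].

(* Meaningful for [1 <= j] only. *)
Definition mart_diff (f : nat -> T -> X) (j : nat) : T -> X :=
  fun w => f j w - f j.-1 w.

Definition norm_infty (g : T -> X) : \bar R :=
  ess_sup P (fun w => (`|g w|)%:E).

Definition maximal (f : nat -> T -> X) : T -> \bar R :=
  fun w => ereal_sup (range (fun j => (`|f j w|)%:E)).

End Bochner.

(* Main.v *)
Require Import Defs.
From HB Require Import structures.
From mathcomp Require Import all_boot all_order all_algebra finmap.
From mathcomp Require Import all_classical all_reals all_analysis ess_sup_inf.
From mathcomp Require Import measurable_realfun ring lra.
Import Order.TTheory GRing.Theory Num.Theory.
Import numFieldNormedType.Exports.
Local Open Scope classical_set_scope.
Local Open Scope ring_scope.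

(** The proof makes a supermartingale out of hyperbolic cosines of norms.

    In a (2, D)-smooth space [cosh] of the norm obeys the second-difference
    inequality
      [cosh |x + y| + cosh |x - y| <= 2 * cosh (D * |y|) * cosh |x|]
    ([smooth2_cosh]). It follows from the inequality between the squared norms,
    because [cosh] is a power series in the square with nonnegative coefficients,
    so that a pair of numbers whose squares are more spread out has a larger sum
    of hyperbolic cosines ([cosh_spread], [cosh_parallelogram]).

    Let [f] and [g] be consecutive terms of the martingale, [|g - f| <= c] almost
    surely, and let [phi t] be the mean of [cosh (l * |f + t * (g - f)|)] over an
    event known at the time of [f]. Integrating the inequality above gives
      [phi (t + h) + phi (t - h) <= 2 * cosh (l * D * c * h) * phi t],
    a discrete form of [phi'' <= (l * D * c) ^ 2 * phi]. Moreover [phi] is minimal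
    at [0] by Jensen's inequality ([jensen_cosh]), as [g - f] has conditional mean
    zero. Comparing [phi] on a grid of step [1 / N] with a hyperbolic cosine and
    letting [N] grow yields [phi 1 <= cosh (l * D * c) * phi 0]
    ([cosh_ode_comparison], [cosh_one_step]).

    Since [cosh u <= exp (u ^ 2 / 2)], the process
      [exp (- (l * D) ^ 2 * S_k / 2) * cosh (l * |f_k|)],
    where [S_k] is the sum of the squared increment bounds up to time [k], is a
    supermartingale that starts at [1]. Doob's maximal inequality
    ([supermartingale_maximal]) bounds the probability that some [|f_k|] reaches
    [r] by [2 * exp (- l * r + (l * D * b) ^ 2 / 2)], and [l = r / (D * b) ^ 2] is
    the best choice.

    For Jensen's inequality, separability cuts an event into countably many cells
    on which [f] is nearly constant, and there the norm bound for Bochner integrals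
    ([bochner_integral_bound]) gives a lower bound for the mean of
    [|f + t * (g - f)|]. *)

(** * Hyperbolic cosine *)

Definition cosh {R : realType} (x : R) : R := (expR x + expR (- x)) / 2.

Section hyperbolic.
Context {R : realType}.
Implicit Types x y a b p q h u v : R.

Lemma coshN x : cosh (- x) = cosh x.
Proof. by rewrite /cosh opprK addrC. Qed.

Lemma cosh0 : cosh 0 = 1 :> R.
Proof. by rewrite /cosh oppr0 expR0; field. Qed.

Lemma cosh_ge1 x : 1 <= cosh x.
Proof. by rewrite /cosh; have := expR_ge1Dx x; have := expR_ge1Dx (- x); lra. Qed.

Lemma cosh_ge0 x : 0 <= cosh x.
Proof. exact: le_trans ler01 (cosh_ge1 x). Qed.

Lemma cosh_gt0 x : 0 < cosh x.
Proof. exact: lt_le_trans ltr01 (cosh_ge1 x). Qed.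

Lemma expR_le_cosh x : expR x <= 2 * cosh x.
Proof. by rewrite /cosh; have := expR_ge0 (- x); lra. Qed.

Lemma coshD_coshB x y : cosh (x + y) + cosh (x - y) = 2 * cosh x * cosh y.
Proof. by rewrite /cosh opprD opprB !expRD; field. Qed.

Lemma coshD_le x y : 0 <= y -> cosh (x + y) <= expR y * cosh x.
Proof.
move=> y0; rewrite /cosh opprD !expRD.
have e : expR (- y) <= expR y by rewrite ler_expR; lra.
have := ler_wpM2l (expR_ge0 (- x)) e; lra.
Qed.

Lemma cosh_tangent m y :
  cosh m + (expR m - expR (- m)) / 2 * (y - m) <= cosh y.
Proof.
have -> : cosh y = cosh (m + (y - m)) by congr cosh; lra.
move: (y - m) => z; rewrite /cosh opprD !expRD.
have := ler_wpM2l (expR_ge0 m) (expR_ge1Dx z).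
have := ler_wpM2l (expR_ge0 (- m)) (expR_ge1Dx (- z)).
lra.
Qed.

Lemma ler_cosh x y : 0 <= x -> x <= y -> cosh x <= cosh y.
Proof.
move=> x0 xy; apply: le_trans (cosh_tangent x y).
rewrite lerDl mulr_ge0 ?subr_ge0// divr_ge0// subr_ge0 ler_expR; lra.
Qed.

(** Even powers only: in the variable [x ^+ 2] the hyperbolic cosine is a power
    series with nonnegative coefficients, so inequalities between hyperbolic
    cosines may be checked on the powers of squares. *)
Lemma cosh_cvg x :
  (\sum_(i < n) (x ^+ 2) ^+ i / (i.*2)`!%:R) @[n --> \oo] --> cosh x.
Proof.
have cE y : series (exp_coeff y) n.*2 @[n --> \oo] --> expR y.
  have := @is_cvg_series_exp_coeff R y.
  move=> /(@cvg_comp _ _ _ (fun n => n.*2)); apply.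
  move=> B [N _ NB]; exists N => //= n /= Nn; apply: NB => /=.
  by rewrite -addnn (leq_trans Nn)// leq_addr.
have -> : (fun n => \sum_(i < n) (x ^+ 2) ^+ i / (i.*2)`!%:R) =
    (fun n =>
      (series (exp_coeff x) n.*2 + series (exp_coeff (- x)) n.*2) * 2^-1).
  apply/funext => n; elim: n => [|n IH].
    by rewrite big_ord0 /series/= !big_geq// addr0 mul0r.
  rewrite big_ord_recr/= IH doubleS /series/= !(big_nat_recr n.*2.+1)//=.
  rewrite !(big_nat_recr n.*2)//= /exp_coeff/= -exprM mul2n.
  have sgn : (-1) ^+ n.*2 = 1 :> R by rewrite -mul2n exprM sqrrN !expr1n.
  rewrite [(- x) ^+ n.*2]exprNn [(- x) ^+ n.*2.+1]exprNn !exprS sgn; field.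
  by rewrite !pnatr_eq0 -!lt0n !fact_gt0.
by apply: cvgMl => //; apply: cvgD; exact: cE.
Qed.

Lemma cosh_le_expR_sqr x : cosh x <= expR (x ^+ 2 / 2).
Proof.
apply: ler_cvg_to (cosh_cvg x) (@is_cvg_series_exp_coeff R (x ^+ 2 / 2)) _.
apply: nearW => n; rewrite /series/= big_mkord; apply: ler_sum => i _.
rewrite /exp_coeff/= expr_div_n -mulrA ler_wpM2l//.
  by rewrite exprn_ge0 ?sqr_ge0.
rewrite -invfM lef_pV2 ?posrE ?mulr_gt0 ?exprn_gt0 ?ltr0n ?fact_gt0//.
rewrite -natrX -natrM ler_nat; elim: (val i) => // k IH.
rewrite doubleS !factS expnS !mulnA.
have -> : (2 * 2 ^ k * k.+1 * k`! = k.+1.*2 * (2 ^ k * k`!))%N.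
  by rewrite -mul2n; ring.
by rewrite doubleS -mulnA leq_mul// (leq_trans IH)// leq_pmull.
Qed.

(** Convexity of [z |-> z ^+ n] on the nonnegative half-line: of two pairs, the
    one that is more spread out has the larger sum of powers. *)
Lemma exprn_spread n u v (U V : R) : 0 <= u -> 0 <= v -> 0 <= V ->
  u <= U -> v <= U -> u + v <= U + V -> u ^+ n + v ^+ n <= U ^+ n + V ^+ n.
Proof.
move=> u0 v0 V0; wlog vu : u v u0 v0 / v <= u => [wl uU vU uv|uU _ uv].
  have [vu|/ltW uv'] := leP v u; first exact: wl.
  by rewrite addrC; apply: wl => //; rewrite addrC.
have U0 : 0 <= U by lra.
have [vV|/ltW Vv] := leP v V; first by apply: lerD; rewrite lerXn2r.
suff : v ^+ n - V ^+ n <= U ^+ n - u ^+ n by lra.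
rewrite !subrXX ler_pM ?sumr_ge0//; try lra.
  by move=> i _; rewrite mulr_ge0// exprn_ge0.
by apply: ler_sum => i _; rewrite ler_pM ?exprn_ge0// lerXn2r// ?nnegrE; lra.
Qed.

Lemma cosh_spread a b (A B : R) : a ^+ 2 <= A ^+ 2 -> b ^+ 2 <= A ^+ 2 ->
  a ^+ 2 + b ^+ 2 <= A ^+ 2 + B ^+ 2 -> cosh a + cosh b <= cosh A + cosh B.
Proof.
move=> aA bA ab.
apply: ler_cvg_to (cvgD (cosh_cvg a) (cosh_cvg b))
  (cvgD (cosh_cvg A) (cosh_cvg B)) _.
apply: nearW => n; rewrite !fctE -!big_split/=; apply: ler_sum => i _.
by rewrite -!mulrDl ler_wpM2r// exprn_spread ?sqr_ge0.
Qed.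

(** The parallelogram inequality passes from squares to hyperbolic cosines: the
    right-hand side is [cosh (p + q) + cosh (p - q)], and the squares of [p + q]
    and [p - q] are more spread out than those of [a] and [b]. *)
Lemma cosh_parallelogram a b p q : 0 <= a -> 0 <= b ->
  a <= p + q -> b <= p + q -> a ^+ 2 + b ^+ 2 <= 2 * p ^+ 2 + 2 * q ^+ 2 ->
  cosh a + cosh b <= 2 * cosh p * cosh q.
Proof.
move=> a0 b0 apq bpq ab; rewrite -coshD_coshB; apply: cosh_spread.
- by rewrite lerXn2r// nnegrE; lra.
- by rewrite lerXn2r// nnegrE; lra.
- by apply: le_trans ab _; rewrite le_eqVlt; apply/orP; left; apply/eqP; ring.
Qed.

(** The comparison sequence [cosh (h * (k - 1/2))] solves the recurrence with
    equality and takes equal values at [k = 0] and [k = 1]. *)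
Lemma cosh_recurrence (phi : nat -> R) h : phi 1%N <= phi 0%N ->
  (forall k, phi k.+2 + phi k <= 2 * cosh h * phi k.+1) ->
  forall k, phi k.+1 <= phi 1%N * cosh (h * (k%:R + 2^-1)) / cosh (h / 2).
Proof.
move=> phi01 rec.
pose psi k : R := phi 1%N * cosh (h * (k%:R - 2^-1)) / cosh (h / 2).
have ch0 : cosh (h / 2) != 0 by rewrite gt_eqF// cosh_gt0.
have psirec k : psi k.+2 + psi k = 2 * cosh h * psi k.+1.
  rewrite /psi -mulrDl -mulrDr.
  have -> : h * (k.+2%:R - 2^-1) = h * (k.+1%:R - 2^-1) + h.
    by rewrite -[k.+2]addn1 natrD; ring.
  have -> : h * (k%:R - 2^-1) = h * (k.+1%:R - 2^-1) - h.
    by rewrite -[k.+1]addn1 natrD; ring.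
  by rewrite coshD_coshB; ring.
have psi1 : psi 1%N = phi 1%N.
  by rewrite /psi (_ : h * (1 - 2^-1) = h / 2) ?mulfK//; field.
have psi0 : psi 0%N = phi 1%N.
  by rewrite /psi (_ : h * (0 - 2^-1) = - (h / 2)) ?coshN ?mulfK//; field.
have D k : psi k - phi k <= psi k.+1 - phi k.+1 /\ 0 <= psi k.+1 - phi k.+1.
  elim: k => [|k [IH1 IH2]]; first by rewrite psi0 psi1 subrr; split => //; lra.
  have := rec k; have := psirec k.
  have : psi k.+1 - phi k.+1 <= cosh h * (psi k.+1 - phi k.+1).
    by rewrite ler_peMl// cosh_ge1.
  by split; lra.
move=> k; have [_] := D k; rewrite subr_ge0 /psi.
by rewrite (_ : k.+1%:R - 2^-1 = k%:R + 2^-1 :> R)// -[k.+1]addn1 natrD; field.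
Qed.

(** Letting a multiplicative error go to [1]; the value [+oo] is allowed. *)
Lemma lee_expR_mul (x K : \bar R) : (0 <= K)%E ->
  (forall e : R, 0 < e -> (x <= (expR e)%:E * K)%E) -> (x <= K)%E.
Proof.
case: K => [K|_ _|//]; last by rewrite leey.
rewrite lee_fin => K0 xK; apply/lee_addgt0Pr => e e0.
have K1 : 0 < K + 1 by lra.
have d0 : 0 < e / (K + 1) by rewrite divr_gt0.
have := xK (ln (1 + e / (K + 1))).
rewrite ln_gt0 ?ltrDl// lnK ?posrE; last by lra.
move=> /(_ isT)/le_trans; apply.
rewrite -EFinM -EFinD lee_fin mulrDl mul1r lerD2l.
by rewrite mulrAC ler_pdivrMr// ler_wpM2l//; lra.
Qed.

(** A discrete form of: [phi'' <= c ^+ 2 * phi] and [phi' 0 <= 0] imply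
    [phi 1 <= cosh c * phi 0]. The one-sided condition on [phi' 0] is replaced by
    minimality at [0], which costs half a step and disappears in the limit. *)
Lemma cosh_ode_comparison (phi : R -> R) c : 0 <= c -> 0 <= phi 0 ->
  (forall t h, phi (t + h) + phi (t - h) <= 2 * cosh (c * h) * phi t) ->
  (forall h, phi 0 <= phi (- h)) ->
  phi 1 <= cosh c * phi 0.
Proof.
move=> c0 phi0 rec phim.
rewrite -lee_fin; apply: lee_expR_mul => [|e e0].
  by rewrite lee_fin mulr_ge0 ?cosh_ge0.
rewrite -EFinM lee_fin.
pose N := (Num.truncn (c / e)).+1.
have N0 : 0 < N%:R :> R by rewrite ltr0n.
have cN : c / N%:R <= e.
  by rewrite ler_pdivrMr// mulrC -ler_pdivrMr// ltW// truncnS_gt.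
(* shifted by one: the index [0] stands for the grid point [- 1 / N] *)
pose f k : R := phi ((k%:R - 1) / N%:R).
have f1 : f 1%N = phi 0 by rewrite /f subrr mul0r.
have := @cosh_recurrence f (c / N%:R) _ _ N.
rewrite f1 (_ : f N.+1 = phi 1); last first.
  by rewrite /f -[N.+1]addn1 natrD addrK divff// gt_eqF.
move=> /(_ _ _)/le_trans; apply.
- by rewrite /f sub0r mulN1r; exact: phim.
- move=> k; rewrite /f.
  have := rec ((k.+1%:R - 1) / N%:R) N%:R^-1.
  have -> : (k.+1%:R - 1) / N%:R + N%:R^-1 = (k.+2%:R - 1) / N%:R :> R.
    by rewrite -[k.+2]addn1 natrD; ring.
  have -> : (k.+1%:R - 1) / N%:R - N%:R^-1 = (k%:R - 1) / N%:R :> R.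
    by rewrite -[k.+1]addn1 natrD; ring.
  by [].
- rewrite -[leLHS]mulrA [leRHS]mulrA [leRHS]mulrC; apply: ler_wpM2l => //.
  rewrite ler_pdivrMr ?cosh_gt0//.
  have -> : c / N%:R * (N%:R + 2^-1) = c + c / N%:R / 2.
    by rewrite mulrDr divfK ?gt_eqF.
  have cN0 : 0 <= c / N%:R by rewrite divr_ge0// ltW.
  apply: le_trans (coshD_le _ _ _) _; first by rewrite divr_ge0.
  rewrite -[leLHS]mulr1 ler_pM ?mulr_ge0 ?expR_ge0 ?cosh_ge0 ?cosh_ge1//.
  by rewrite ler_wpM2r ?cosh_ge0// ler_expR; lra.
Qed.

End hyperbolic.

(** * Bochner integrals in a separable space *)

Lemma separable_seq {R : realType} {X : normedModType R} : separable X ->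
  exists a : nat -> X, forall x e, 0 < e -> exists i, `|x - a i| < e.
Proof.
move=> [S [cS dS]].
have dS' (x : X) (e : R) : 0 < e -> exists2 y, S y & `|x - y| < e.
  move=> e0; have [|y [xy Sy]] := dS (ball x e) _ (ball_open x e).
    by exists x; exact: ballxx.
  by exists y => //; move: xy; rewrite -ball_normE.
have [S0|[g]] := elimT pfcard_geP cS.
  by have [y] := dS' 0 1 ltr01; rewrite S0.
exists g => x e e0; have [y Sy xy] := dS' x e e0.
by have [i _ gi] := 'surj_g Sy; exists i; rewrite gi.
Qed.

Section bochner.
Context {d : measure_display} {T : measurableType d} {R : realType}.
Context {P : probability T R} {X : completeNormedModType R}.
Implicit Types (f g s : T -> X) (A : set T).

(** Distances to fixed points, rather than Borel preimages: their measurability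
    passes to sums through a countable infimum and suffices to integrate norms. *)
Definition norm_measurable f :=
  forall a : X, measurable_fun setT (fun w => `|f w - a|).

Lemma norm_measurable_norm f A : norm_measurable f ->
  measurable_fun A (fun w => `|f w|).
Proof.
move=> /(_ 0) mf; apply: (@measurable_funS _ _ _ _ setT) => //.
by under eq_fun do rewrite -[f _]subr0.
Qed.

Lemma borel_norm_measurable f : borel_measurable measurable f ->
  norm_measurable f.
Proof.
move=> mf a mT; apply: (measurability _ (RGenInftyO.measurableE R)) => //.
move=> _ [_ [x ->] <-]; rewrite setTI.
have -> : (fun w => `|f w - a|) @^-1` `]-oo, x[ =
    f @^-1` [set y | `|y - a| < x].
  by apply/seteqP; split => w /=; rewrite in_itv.
apply: mf; apply: sub_sigma_algebra.
have := @open_comp _ _ (fun y : X => `|y - a|) [set z | z < x].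
apply; last exact: open_lt.
move=> y _; apply: (@cvg_norm _ _ _ (nbhs y)); apply: cvgB; first exact: cvg_id.
exact: cvg_cst.
Qed.

Lemma norm_measurableZ f (c : R) : norm_measurable f ->
  norm_measurable (fun w => c *: f w).
Proof.
move=> mf a; have [->|c0] := eqVneq c 0.
  by under eq_fun do rewrite scale0r; exact: measurable_cst.
have -> : (fun w => `|c *: f w - a|) = (fun w => `|c| * `|f w - c^-1 *: a|).
  by apply/funext => w; rewrite -normrZ scalerBr scalerA divff// scale1r.
by apply: measurable_funM => //; exact: mf.
Qed.

(** The triangle inequality [|f + g - a| <= |f - s| + |g - (a - s)|] becomes an
    equality after taking the infimum over a countable dense set of [s]. *)
Lemma norm_measurableD f g : separable X ->
  norm_measurable f -> norm_measurable g ->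
  norm_measurable (fun w => f w + g w).
Proof.
move=> /separable_seq[s sP] mf mg a.
pose h i w := `|f w - s i| + `|g w - (a - s i)|.
have split_at w y : f w - y + (g w - (a - y)) = f w + g w - a.
  by rewrite opprB addrACA addKr.
have lb w : lbound (range (h ^~ w)) `|f w + g w - a|.
  by move=> _ [i _ <-]; rewrite -(split_at w (s i)); exact: ler_normD.
have -> : (fun w => `|f w + g w - a|) = (fun w => infs (h ^~ w) 0%N).
  apply/funext => w; rewrite /infs/=.
  have -> : sdrop (h ^~ w) 0 = range (h ^~ w).
    by rewrite /sdrop; congr image; apply/seteqP; split.
  apply/eqP; rewrite eq_le; apply/andP; split.
    by apply: lb_le_inf => //; exists (h 0%N w); exists 0%N.
  apply/ler_addgt0Pr => e e0.
  have [|i fs] := sP (f w) (e / 2); first by rewrite divr_gt0.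
  apply: (@le_trans _ _ (h i w)).
    by apply: ge_inf; [exists `|f w + g w - a|; exact: lb|exists i].
  rewrite /h.
  have : `|g w - (a - s i)| <= `|f w + g w - a| + `|f w - s i|.
    rewrite -(split_at w (s i)) -{1}(addKr (f w - s i) (g w - _)) addrC.
    exact: ler_normB.
  lra.
apply: measurable_fun_infs; first by move=> w _; exists `|f w + g w - a|.
by move=> i; apply: measurable_funD; [exact: mf|exact: mg].
Qed.

Lemma norm_measurable_segment f g (t : R) : separable X ->
  norm_measurable f -> norm_measurable g ->
  norm_measurable (fun w => f w + t *: (g w - f w)).
Proof.
move=> sepX mf mg.
have := norm_measurableD _ _ sepX (norm_measurableZ _ (1 - t) mf)
  (norm_measurableZ _ t mg).
congr norm_measurable; apply/funext => w.
by rewrite scalerBl scale1r scalerBr addrAC addrA.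
Qed.

(** Invariance under refinement of the partition into level sets. Linearity follows
    by passing to a common refinement, here the level sets of a pair. *)
Lemma simple_integral_comp (Z : choiceType) (tau : T -> Z) (phi : Z -> X) A :
  measurable A -> finite_set (range tau) ->
  (forall z, measurable (tau @^-1` [set z])) ->
  simple_integral P A (phi \o tau) =
  \sum_(z <- fset_set (range tau))
    fine (P (A `&` tau @^-1` [set z])) *: phi z.
Proof.
move=> mA ftau mtau; rewrite /simple_integral.
have rE : range (phi \o tau) = phi @` range tau by rewrite image_comp.
have fphi : finite_set (range (phi \o tau)) by rewrite rE; exact: finite_image.
pose p z := fine (P (A `&` tau @^-1` [set z])).
have mAt z : measurable (A `&` tau @^-1` [set z]) by exact: measurableI.
have pE x : fine (P (A `&` (phi \o tau) @^-1` [set x])) =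
    \sum_(z <- fset_set (range tau)) if phi z == x then p z else 0.
  pose F z := if phi z == x then A `&` tau @^-1` [set z] else set0.
  have -> : A `&` (phi \o tau) @^-1` [set x] = \bigcup_(z in range tau) F z.
    apply/seteqP; split => [w [Aw /= wx]|w [z _]].
      by exists (tau w) => //; rewrite /F wx eqxx.
    by rewrite /F; case: ifPn => // /eqP zx [Aw /= ->].
  rewrite measure_fin_bigcup//; last 2 first.
  - move=> z z' _ _ [w []]; rewrite /F.
    by do 2 case: ifPn => // _; move=> [_ <-] [_ <-].
  - by move=> z _; rewrite /F; case: ifPn.
  rewrite fsbig_finite//= -[RHS]/(fine (_%:E)) -sumEFin; congr fine.
  apply: eq_bigr => z _; rewrite /F; case: ifPn => _; last by rewrite measure0.
  by rewrite fineK// fin_num_measure.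
rewrite fsbig_finite//=.
under eq_bigr do rewrite pE scaler_suml.
rewrite exchange_big/=; apply: eq_big_seq => z zr.
have {}zr : range tau z by apply/set_mem; rewrite -(in_fset_set ftau).
have phiz : phi z \in fset_set (range (phi \o tau)).
  by rewrite in_fset_set// inE rE; exists z.
rewrite (bigD1_seq _ phiz)/= ?fset_uniq// eqxx big1 ?addr0// => x.
rewrite eq_sym => /negbTE ->.
by rewrite scale0r.
Qed.

Lemma simple_vector_cst (a : X) : simple_vector (fun _ : T => a).
Proof.
split; first by apply: (@sub_finite_set _ _ [set a]) => // x [_ _ <-].
move=> x; have [<-|ax] := eqVneq a x.
  by rewrite (_ : _ @^-1` _ = setT)//; apply/seteqP; split.
rewrite (_ : _ @^-1` _ = set0)//; apply/seteqP; split => // w /= ax'.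
by rewrite ax' eqxx in ax.
Qed.

Lemma simple_integral_cst A (a : X) : measurable A ->
  simple_integral P A (fun=> a) = fine (P A) *: a.
Proof.
move=> mA; have [->|/set0P[w _]] := eqVneq A set0.
  rewrite measure0 scale0r /simple_integral; apply: fsbig1 => x _.
  by rewrite set0I measure0 scale0r.
rewrite /simple_integral (_ : range _ = [set a]).
  rewrite fsbig_set1 (_ : _ @^-1` _ = setT) ?setIT//.
  by apply/seteqP; split.
by apply/seteqP; split => [_ [_ _ <-]//|x ->]; exists w.
Qed.

Section two_simple_vectors.
Variables (s s' : T -> X) (hs : simple_vector s) (hs' : simple_vector s').
Let tau w := (s w, s' w).

Let finite_tau : finite_set (range tau).
Proof.
apply: (@sub_finite_set _ _ (range s `*` range s')).
  by move=> _ [w _ <-]; split; exists w.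
by apply: finite_setX; [exact: hs.1|exact: hs'.1].
Qed.

Let measurable_tau z : measurable (tau @^-1` [set z]).
Proof.
rewrite (_ : _ @^-1` _ = s @^-1` [set z.1] `&` s' @^-1` [set z.2]).
  by apply: measurableI; [exact: hs.2|exact: hs'.2].
by case: z => x y; apply/seteqP; split => w /= [<- <-].
Qed.

Lemma simple_vector_linear (u v : R) :
  simple_vector (fun w => u *: s w + v *: s' w).
Proof.
split.
  have := finite_image (fun z : X * X => u *: z.1 + v *: z.2) finite_tau.
  by rewrite image_comp.
move=> x; rewrite (_ : _ @^-1` _ = \bigcup_(z in range tau `&`
    [set z | u *: z.1 + v *: z.2 = x]) tau @^-1` [set z]).
  apply: fin_bigcup_measurable => //; exact: finite_setIl.
apply/seteqP; split => [w /= wx|w [z [_ /= <-] /= <-]//].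
by exists (tau w) => //; split => //; exists w.
Qed.

Lemma simple_integral_linear A (u v : R) : measurable A ->
  simple_integral P A (fun w => u *: s w + v *: s' w) =
  u *: simple_integral P A s + v *: simple_integral P A s'.
Proof.
move=> mA.
have := simple_integral_comp _ tau (fun z : X * X => u *: z.1 + v *: z.2) A mA
  finite_tau measurable_tau.
have := simple_integral_comp _ tau (fun z : X * X => z.1) A mA
  finite_tau measurable_tau.
have := simple_integral_comp _ tau (fun z : X * X => z.2) A mA
  finite_tau measurable_tau.
rewrite /comp/= => -> -> ->; rewrite !scaler_sumr -big_split.
apply: eq_bigr => z _.
by rewrite scalerDr !scalerA ![_ * fine _]mulrC.
Qed.

End two_simple_vectors.

Lemma simple_norm_measurable s : simple_vector s -> norm_measurable s.
Proof.
move=> hs a mT Y mY; rewrite setTI.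
rewrite (_ : _ @^-1` Y = \bigcup_(x in range s `&` [set x | Y `|x - a|])
    s @^-1` [set x]).
  apply: fin_bigcup_measurable; first by apply: finite_setIl; exact: hs.1.
  by move=> x _; exact: hs.2.
apply/seteqP; split => [w /= wx|w [x [_ /= Yx] /= ->]//].
by exists (s w) => //; split => //; exists w.
Qed.

Lemma simple_integral_norm A s : measurable A -> simple_vector s ->
  ((`|simple_integral P A s|)%:E <= \int[P]_(w in A) (`|s w|)%:E)%E.
Proof.
move=> mA hs.
have -> : (\int[P]_(w in A) (`|s w|)%:E =
    \int[P]_(w in A) \sum_(x \in range s)
      ((`|x|)%:E * (\1_(s @^-1` [set x]) w)%:E))%E.
  apply: eq_integral => w _; rewrite fsbig_finite; last exact: hs.1.
  have sw : s w \in fset_set (range s).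
    by rewrite (in_fset_set hs.1) inE; exists w.
  rewrite (bigD1_seq _ sw)/= ?fset_uniq// indicE mem_set// mule1.
  rewrite big1_seq ?adde0// => x /andP[xs _].
  rewrite indicE memNset ?mule0//= => sx; by rewrite sx eqxx in xs.
rewrite ge0_integral_fsum//; last exact: hs.1.
- rewrite /simple_integral !fsbig_finite; [|exact: hs.1..].
  apply: (@le_trans _ _ (\sum_(x <- fset_set (range s))
      fine (P (A `&` s @^-1` [set x])) * `|x|)%:E).
    rewrite lee_fin (le_trans (ler_norm_sum _ _ _))// ler_sum// => x _.
    by rewrite normrZ ger0_norm// fine_ge0.
  rewrite -sumEFin; apply: lee_sum => x _.
  rewrite ge0_integralZl//; last first.
    by apply/measurable_EFinP; apply: measurable_indic; exact: hs.2.
  rewrite integral_indic//; last exact: hs.2.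
  rewrite EFinM fineK ?fin_num_measure//; first by rewrite muleC setIC.
  by apply: measurableI => //; exact: hs.2.
- move=> x; apply: measurable_funeM; apply/measurable_EFinP.
  by apply: measurable_indic; exact: hs.2.
Qed.

(** Linearity and the norm bound in one estimate, with explicit errors. With
    [f = f'], [u = 1] and [v = -1] the integral on the right vanishes, which makes
    the integrals of an approximating sequence Cauchy. *)
Lemma simple_approx_linear_bound A f f' s s' (u v : R) : separable X ->
  measurable A -> norm_measurable f -> norm_measurable f' ->
  simple_vector s -> simple_vector s' ->
  ((`|u *: simple_integral P A s + v *: simple_integral P A s'|)%:E <=
   \int[P]_(w in A) (`|u *: f w + v *: f' w|)%:E +
   (`|u|%:E * \int[P]_(w in A) (`|f w - s w|)%:E +
    `|v|%:E * \int[P]_(w in A) (`|f' w - s' w|)%:E))%E.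
Proof.
move=> sepX mA mf mf' hs hs'.
have ms := simple_norm_measurable _ hs.
have ms' := simple_norm_measurable _ hs'.
have mlin g g' (y z : R) : norm_measurable g -> norm_measurable g' ->
    norm_measurable (fun w => y *: g w + z *: g' w).
  by move=> mg mg'; apply: norm_measurableD => //; exact: norm_measurableZ.
have msub g g' : norm_measurable g -> norm_measurable g' ->
    measurable_fun A (fun w => (`|g w - g' w|)%:E).
  move=> mg mg'; apply/measurable_EFinP.
  have := norm_measurable_norm _ A (mlin _ _ 1 (-1) mg mg').
  by under eq_fun do rewrite scale1r scaleN1r.
have mlinE g g' : norm_measurable g -> norm_measurable g' ->
    measurable_fun A (fun w => (`|u *: g w + v *: g' w|)%:E).
  by move=> mg mg'; apply/measurable_EFinP/norm_measurable_norm/mlin.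
rewrite -simple_integral_linear//.
have hl := simple_vector_linear _ _ hs hs' u v.
apply: le_trans (simple_integral_norm _ _ mA hl) _.
rewrite -!ge0_integralZl ?lee_fin//; [|exact: msub..].
rewrite -!ge0_integralD//; last 5 first.
- exact: mlinE.
- by move=> w _; rewrite adde_ge0// mule_ge0.
- by apply: emeasurable_funD; apply: measurable_funeM; exact: msub.
- by apply: measurable_funeM; exact: msub.
- by apply: measurable_funeM; exact: msub.
apply: ge0_le_integral => //.
- exact: mlinE.
- apply: emeasurable_funD; first exact: mlinE.
  by apply: emeasurable_funD; apply: measurable_funeM; exact: msub.
move=> w _; rewrite -!EFinM -!EFinD lee_fin -!normrZ.
rewrite [leLHS](_ : _ = `|(u *: f w + v *: f' w) -
    (u *: (f w - s w) + v *: (f' w - s' w))|).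
  by rewrite (le_trans (ler_normB _ _))// lerD2l ler_normD.
congr `|_|; rewrite !scalerBr addrACA -opprD opprB addrCA.
by rewrite subrr addr0.
Qed.

(** The value chosen for [bochner_integral] is itself a limit along some
    approximating sequence, provided that one such limit exists; completeness
    supplies it. *)
Lemma bochner_integral_approx A f : separable X -> measurable A ->
  bochner_integrable P f ->
  exists2 s, simple_approx P A f s &
    simple_integral P A (s n) @[n --> \oo] --> bochner_integral P A f.
Proof.
move=> sepX mA [bf [s [hs cs]]].
have mf := borel_norm_measurable _ bf.
have msub n : measurable_fun setT (fun w => (`|f w - s n w|)%:E).
  apply/measurable_EFinP.
  have ms : norm_measurable (fun w => - s n w).
    have := norm_measurableZ _ (-1) (simple_norm_measurable _ (hs n)).
    by rewrite (_ : (fun w => -1 *: _) = (fun w => - s n w))//;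
      apply/funext => w; rewrite scaleN1r.
  exact: (norm_measurable_norm _ _ (norm_measurableD _ _ sepX mf ms)).
have csA : simple_approx P A f s.
  split=> //; apply: (@squeeze_cvge _ _ _ _ (cst 0%E) _ (fun n =>
    \int[P]_w (`|f w - s n w|)%:E)%E) => //; last exact: cvg_cst.
  apply: nearW => n; rewrite integral_ge0//=.
  exact: ge0_subset_integral.
have : cvgn (fun n => simple_integral P A (s n)).
  apply/cauchy_cvgP/cauchy_exP => e e0.
  have e20 : 0 < e / 2 by rewrite divr_gt0.
  have := csA.2 => /fine_cvgP[fin /cvgrPdist_lt /(_ _ e20) small].
  have [N _ NP] : \forall n \near \oo,
      (\int[P]_(w in A) (`|f w - s n w|)%:E < (e / 2)%:E)%E.
    near=> n.
    have fn : (\int[P]_(w in A) (`|f w - s n w|)%:E)%E \is a fin_num.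
      by near: n.
    rewrite -(fineK fn) lte_fin -[ltLHS]ger0_norm ?fine_ge0 ?integral_ge0//.
    by rewrite -normrN -sub0r; near: n.
  exists (simple_integral P A (s N)); exists N => //= n Nn.
  rewrite -ball_normE/=.
  have := simple_approx_linear_bound A f f (s N) (s n) 1 (-1) sepX mA mf mf
    (hs _) (hs _).
  rewrite scale1r scaleN1r normrN normr1 !mul1e -lte_fin => /le_lt_trans; apply.
  under eq_integral do rewrite scale1r scaleN1r subrr normr0.
  by rewrite integral0 add0e [e]splitr EFinD lteD//; apply: NP => /=.
move=> /cvg_ex[m cm].
have := @xgetPex _ 0 [set m : X | exists s : nat -> T -> X,
  simple_approx P A f s /\ simple_integral P A (s n) @[n --> \oo] --> m].
by case=> [|s' [? ?]]; [exists m, s|exists s'].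
Unshelve. all: by end_near. Qed.

(** The norm of an integral is at most the integral of the norm. Stated for limits
    along approximating sequences, it applies to pairs of Bochner integrals as well
    as to a Bochner integral and a constant. *)
Lemma bochner_integral_bound A f f' (s s' : nat -> T -> X) (m m' : X) (u v : R) :
  separable X ->
  measurable A -> norm_measurable f -> norm_measurable f' ->
  simple_approx P A f s -> simple_integral P A (s n) @[n --> \oo] --> m ->
  simple_approx P A f' s' -> simple_integral P A (s' n) @[n --> \oo] --> m' ->
  ((`|u *: m + v *: m'|)%:E <= \int[P]_(w in A) (`|u *: f w + v *: f' w|)%:E)%E.
Proof.
move=> sepX mA mf mf' [hs cs] sm [hs' cs'] sm'.
set J := (\int[P]_(w in A) _)%E.
have [->|Joo] := eqVneq J +oo%E; first by rewrite leey.
have J0 : (0 <= J)%E by rewrite integral_ge0.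
have Jfin : J \is a fin_num by rewrite ge0_fin_numE// lt_neqAle Joo leey.
have cl : (`|u *: simple_integral P A (s n) +
      v *: simple_integral P A (s' n)|)%:E
    @[n --> \oo] --> (`|u *: m + v *: m'|)%:E.
  apply: cvg_EFin; first exact: nearW.
  by apply: cvg_norm; apply: cvgD; apply: cvgZr.
have cr : (J + (`|u|%:E * \int[P]_(w in A) (`|f w - s n w|)%:E +
    `|v|%:E * \int[P]_(w in A) (`|f' w - s' n w|)%:E))%E @[n --> \oo] --> J.
  have E : (J = J + (`|u|%:E * 0 + `|v|%:E * 0))%E by rewrite !mule0 !adde0.
  rewrite [X in _ --> X]E.
  apply: cvgeD; [by rewrite fin_num_adde_defr|exact: cvg_cst|].
  by apply: cvgeD; [by rewrite !mule0|apply: cvgeZl..].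
apply: lee_cvg_to cl cr _; apply: nearW => n.
exact: simple_approx_linear_bound.
Qed.

(** Replacing [g] by [f] inside the combination is allowed because only the
    integrals over [A] enter: there [f + t * (g - f)] has the same integral as
    [f], which is close to [P A *: a]. *)
Lemma le_integral_norm_increment A f g (a : X) (e t : R) : separable X ->
  measurable A -> bochner_integrable P f -> bochner_integrable P g ->
  bochner_integral P A g = bochner_integral P A f ->
  (forall w, A w -> `|f w - a| <= e) ->
  ((`|a| - e)%:E * P A <= \int[P]_(w in A) (`|f w + t *: (g w - f w)|)%:E)%E.
Proof.
move=> sepX mA bf bg gf fa.
have mf := borel_norm_measurable _ bf.1.
have mg := borel_norm_measurable _ bg.1.
have [s sf cs] := bochner_integral_approx A f sepX mA bf.
have [s' sg cs'] := bochner_integral_approx A g sepX mA bg.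
have mcst : norm_measurable (fun _ : T => a) by move=> x; exact: measurable_cst.
have acst : simple_approx P A (fun=> a) (fun=> fun=> a).
  split; first by move=> _; exact: simple_vector_cst.
  under eq_fun do under eq_integral do rewrite subrr normr0.
  by rewrite integral0; exact: cvg_cst.
have ccst :
    simple_integral P A (fun _ : T => a) @[n --> \oo] --> fine (P A) *: a.
  by rewrite simple_integral_cst//; exact: cvg_cst.
have PA : P A \is a fin_num by rewrite fin_num_measure.
have h1 := bochner_integral_bound A f (fun=> a) _ _ _ _ 1 (-1) sepX mA mf mcst
  sf cs acst ccst.
have h2 := bochner_integral_bound A f g _ _ _ _ (1 - t) t sepX mA mf mg
  sf cs sg cs'.
move: h2; rewrite gf -scalerDl subrK scale1r.
have -> : (\int[P]_(w in A) (`|(1 - t) *: f w + t *: g w|)%:E =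
  \int[P]_(w in A) (`|f w + t *: (g w - f w)|)%:E)%E.
  apply: eq_integral => w _; congr (`|_|%:E).
  by rewrite scalerBl scale1r scalerBr addrAC addrA.
apply: le_trans.
have : (\int[P]_(w in A) (`|1 *: f w + -1 *: a|)%:E <= e%:E * P A)%E.
  rewrite -integral_cst//; apply: ge0_le_integral => //.
  - apply/measurable_EFinP; under eq_fun do rewrite scale1r scaleN1r.
    exact: measurable_funS (mf a).
  - by move=> w Aw; rewrite lee_fin scale1r scaleN1r fa.
move=> /(le_trans h1); rewrite -[P A]fineK// -!EFinM !lee_fin scale1r scaleN1r.
set I := bochner_integral _ _ _; have p0 : 0 <= fine (P A) by rewrite fine_ge0.
have := ler_distD I (fine (P A) *: a) 0.
rewrite !subr0 normrZ ger0_norm// distrC; lra.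
Qed.

End bochner.

(** * Doob's maximal inequality *)

Lemma sigma_algebra_setI (T : pointedType) (G : set (set T)) (A B : set T) :
  sigma_algebra setT G -> G A -> G B -> G (A `&` B).
Proof.
move=> sG GA GB; rewrite -(sigma_algebra_id sG).
by apply: (@measurableI _ (g_sigma_algebraType G)); exact: sub_sigma_algebra.
Qed.

Lemma sigma_algebra_setD (T : pointedType) (G : set (set T)) (A B : set T) :
  sigma_algebra setT G -> G A -> G B -> G (A `\` B).
Proof.
move=> sG GA GB; rewrite -(sigma_algebra_id sG).
by apply: (@measurableD _ (g_sigma_algebraType G)); exact: sub_sigma_algebra.
Qed.

(** Doob's maximal inequality: on the first of the events [E k] to occur, the
    process is at least [y] and has not increased in mean since time [0]. *)
Lemma supermartingale_maximal d (T : measurableType d) (R : realType)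
    (P : probability T R) (F : nat -> set (set T)) (Y : nat -> T -> \bar R)
    (E : nat -> set T) (y : R) : filtration F -> 0 <= y ->
  (forall k w, (0 <= Y k w)%E) -> (forall k, measurable_fun setT (Y k)) ->
  (forall k A, F k A ->
    (\int[P]_(w in A) Y k.+1 w <= \int[P]_(w in A) Y k w)%E) ->
  (forall k, F k (E k)) -> (forall k w, E k w -> (y%:E <= Y k w)%E) ->
  (y%:E * P (\bigcup_k E k) <= \int[P]_w Y 0%N w)%E.
Proof.
move=> [sF mF nF] y0 Y0 mY Ydec FE yE.
pose U n := \big[setU/set0]_(i < n) E i.
have FU n : F n (~` U n).
  rewrite -setTD; elim: n => [|n IH].
    by have [F0 FD _] := sF 0%N; apply: FD; rewrite /U big_ord0.
  rewrite /U big_ord_recr/= setDUr; apply: (nF n n.+1 (leqnSn n)).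
  apply: sigma_algebra_setI => //.
  by have [_ FD _] := sF n; apply: FD; exact: FE.
have mU n : measurable (U n).
  by apply: bigsetU_measurable => i _; exact: mF (FE i).
have mYA A n : measurable_fun A (Y n) by exact: measurable_funS (mY n).
have step n : (y%:E * P (U n) + \int[P]_(w in ~` U n) Y n w <=
    \int[P]_w Y 0%N w)%E.
  elim: n => [|n]; first by rewrite /U big_ord0 measure0 mule0 add0e setC0.
  apply: le_trans.
  have mE : measurable (E n) by exact: mF (FE n).
  have -> : U n.+1 = U n `|` (~` U n `&` E n).
    by rewrite /U big_ord_recr/= setUIr setUv setTI.
  have -> : ~` (U n `|` (~` U n `&` E n)) = ~` U n `\` E n.
    by rewrite setCU setCI setCK setIUr setICl set0U setDE.
  have mUE : measurable (~` U n `&` E n).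
    by apply: measurableI => //; exact: measurableC.
  have mUD : measurable (~` U n `\` E n).
    by apply: measurableD => //; exact: measurableC.
  rewrite measureU//; last by rewrite setIA setICr set0I.
  rewrite muleDr ?ge0_adde_def ?inE// -addeA leeD2l//.
  rewrite -{3}(setUIDK (~` U n) (E n)) ge0_integral_setU//; last 1 first.
    by apply/disj_setPS => w [[_ Ew] [_ /(_ Ew)]].
  apply: leeD.
    by rewrite -integral_cst//; apply: ge0_le_integral => // w [_ /yE].
  apply: Ydec; exact: sigma_algebra_setD.
have cU : (y%:E * P (U n.+1))%E @[n --> \oo] --> (y%:E * P (\bigcup_k E k))%E.
  apply: cvgeZl => //; rewrite -bigcup_bigsetU_bigcup.
  apply: nondecreasing_cvg_mu => //.
  - by apply: bigcupT_measurable => n; exact: mU.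
  - by move=> m n mn; apply/subsetPset/subset_bigsetU; rewrite ltnS.
apply: lee_cvg_to cU (cvg_cst _) _; apply: nearW => n.
by apply: le_trans (step n.+1); rewrite leeDl// integral_ge0.
Qed.

(** * One step of the martingale *)

Lemma measurable_cosh (R : realType) : measurable_fun setT (@cosh R).
Proof.
apply: measurable_funM => //; apply: measurable_funD => //.
by apply: measurableT_comp => //; exact: measurable_oppr.
Qed.

(** Smoothness enters only here: it supplies the inequality between squared
    norms that [cosh_parallelogram] turns into one between hyperbolic cosines. *)
Lemma smooth2_cosh (R : realType) (X : normedModType R) (D l c : R) (x y : X) :
  smooth2 X D -> 0 <= D -> 0 <= l -> `|y| <= c ->
  cosh (l * `|x + y|) + cosh (l * `|x - y|) <=
  2 * cosh (l * D * c) * cosh (l * `|x|).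
Proof.
move=> sX D0 l0 yc.
have Dy : `|y| <= D * `|y|.
  rewrite -(@ler_pXn2r _ 2)// ?nnegrE ?mulr_ge0// exprMn.
  have := sX 0 y; rewrite add0r sub0r normrN normr0 expr0n/=; lra.
have l2 : 0 <= l ^+ 2 by rewrite sqr_ge0.
apply: (@le_trans _ _ (2 * cosh (l * `|x|) * cosh (l * D * `|y|))); last first.
  rewrite mulrAC; apply: ler_wpM2r; first exact: cosh_ge0.
  apply: ler_wpM2l => //; apply: ler_cosh; first by rewrite !mulr_ge0.
  by rewrite ler_wpM2l// mulr_ge0.
apply: cosh_parallelogram; rewrite ?mulr_ge0//.
- by rewrite -mulrA -mulrDr ler_wpM2l// (le_trans (ler_normD _ _))// lerD2l.
- by rewrite -mulrA -mulrDr ler_wpM2l// (le_trans (ler_normB _ _))// lerD2l.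
- by have := ler_wpM2l l2 (sX x y); rewrite !exprMn; lra.
Qed.

Lemma measurable_cosh_norm d (T : measurableType d) (R : realType)
    (X : completeNormedModType R) (f : T -> X) (l : R) (A : set T) :
  norm_measurable f -> measurable_fun A (fun w => (cosh (l * `|f w|))%:E).
Proof.
move=> mf; apply/measurable_EFinP; apply: measurableT_comp.
  exact: measurable_cosh.
by apply: measurable_funM => //; exact: norm_measurable_norm.
Qed.

Section one_step.
Context {d : measure_display} {T : measurableType d} {R : realType}.
Context {P : probability T R} {X : completeNormedModType R}.
Variables (sepX : separable X) (G : set (set T)) (f g : T -> X).
Hypotheses (sG : sigma_algebra setT G) (mG : G `<=` measurable).
Hypotheses (Gf : borel_measurable G f) (bf : bochner_integrable P f)
  (bg : bochner_integrable P g).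
Hypothesis gf :
  forall A, G A -> bochner_integral P A g = bochner_integral P A f.
Variables (l : R) (l0 : 0 <= l).

Let mf : norm_measurable f := borel_norm_measurable _ bf.1.
Let mg : norm_measurable g := borel_norm_measurable _ bg.1.

(** Jensen's inequality on a cell where [f] is nearly the constant [a], obtained
    by integrating the tangent of [cosh] at the positive part of [l * (|a| - e)]. *)
Lemma jensen_cosh_cell A (a : X) (e t : R) : G A -> 0 <= e ->
  (forall w, A w -> `|f w - a| <= e) ->
  (\int[P]_(w in A) (cosh (l * `|f w|))%:E <=
   (expR (2 * l * e))%:E *
   \int[P]_(w in A) (cosh (l * `|f w + t *: (g w - f w)|))%:E)%E.
Proof.
move=> GA e0 fa; have mA := mG _ GA.
have PA : P A \is a fin_num by rewrite fin_num_measure.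
(* a lower bound of the mean of [l * |f + t * (g - f)|], where the tangent is
   taken *)
pose m := l * Num.max (`|a| - e) 0.
have m0 : 0 <= m by rewrite mulr_ge0// le_max lexx orbT.
pose S := (expR m - expR (- m)) / 2.
have S0 : 0 <= S by rewrite divr_ge0// subr_ge0 ler_expR; lra.
have tan y : cosh m + S * (y - m) <= cosh y by exact: cosh_tangent.
clearbody S.
apply: (@le_trans _ _ ((expR (2 * l * e) * cosh m)%:E * P A)%E).
  rewrite -integral_cst//; apply: ge0_le_integral => //.
  - by move=> w _; rewrite lee_fin cosh_ge0.
  - exact: measurable_cosh_norm mf.
  - move=> w Aw; rewrite lee_fin.
    apply: (@le_trans _ _ (cosh (m + 2 * l * e))); last first.
      by apply: coshD_le; rewrite !mulr_ge0.
    apply: ler_cosh; first by rewrite mulr_ge0.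
    have -> : m + 2 * l * e = l * (Num.max (`|a| - e) 0 + 2 * e).
      by rewrite /m; ring.
    apply: ler_wpM2l => //.
    have : `|a| - e <= Num.max (`|a| - e) 0 by rewrite le_max lexx.
    have := fa w Aw; have := ler_normD (f w - a) a; rewrite subrK; lra.
rewrite EFinM -muleA lee_wpmul2l ?lee_fin ?expR_ge0//.
set J := (\int[P]_(w in A) _)%E.
set I := (\int[P]_(w in A) (`|f w + t *: (g w - f w)|)%:E)%E.
have I0 : (0 <= I)%E by rewrite integral_ge0.
have mPI : (m%:E * P A <= l%:E * I)%E.
  rewrite /m EFinM -muleA lee_wpmul2l ?lee_fin//.
  have [_|_] := leP (`|a| - e) 0; first by rewrite mul0e.
  exact: le_integral_norm_increment (gf _ GA) fa.
have : ((cosh m)%:E * P A + S%:E * (l%:E * I) <= J + (S * m)%:E * P A)%E.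
  have mI : measurable_fun A (fun w => (`|f w + t *: (g w - f w)|)%:E).
    apply/measurable_EFinP.
    exact: norm_measurable_norm (norm_measurable_segment _ _ t sepX mf mg).
  have mJ : measurable_fun A (fun w =>
    (cosh (l * `|f w + t *: (g w - f w)|))%:E).
    exact: measurable_cosh_norm (norm_measurable_segment _ _ t sepX mf mg).
  rewrite -!integral_cst// /I -!ge0_integralZl ?lee_fin//; last 2 first.
  - exact: measurable_funeM.
  - by move=> w _; rewrite -EFinM lee_fin mulr_ge0.
  have K0 : (0 <= (S * m)%:E)%E by rewrite lee_fin mulr_ge0.
  rewrite -!ge0_integralD//.
  - apply: ge0_le_integral => //.
    + move=> w _; rewrite /= -!EFinM -EFinD lee_fin.
      by rewrite addr_ge0 ?cosh_ge0// !mulr_ge0.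
    + apply: (emeasurable_funD (measurable_cst _)).
      by do 2 apply: measurable_funeM.
    + exact: (emeasurable_funD _ (measurable_cst _)).
    + move=> w _; rewrite -!EFinM -!EFinD lee_fin.
      by have := tan (l * `|f w + t *: (g w - f w)|); lra.
  - by move=> w _; rewrite lee_fin cosh_ge0.
  - by move=> w _; rewrite lee_fin cosh_ge0.
  - by move=> w _; rewrite -!EFinM lee_fin !mulr_ge0.
  - by do 2 apply: measurable_funeM.
have := lee_wpmul2l (_ : 0 <= S%:E)%E mPI; rewrite lee_fin => /(_ S0) SmP.
move=> /(le_trans (leeD2l _ SmP)); rewrite muleA -EFinM leeD2rE//.
by rewrite fin_numM.
Qed.

(** Separability cuts [A] into countably many cells on which [f] is nearly
    constant; the error on each of them is a factor, hence uniform. *)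
Lemma jensen_cosh A t : G A ->
  (\int[P]_(w in A) (cosh (l * `|f w|))%:E <=
   \int[P]_(w in A) (cosh (l * `|f w + t *: (g w - f w)|))%:E)%E.
Proof.
move=> GA; have [a aP] := separable_seq sepX.
apply: lee_expR_mul => [|e e0].
  by apply: integral_ge0 => w _; rewrite lee_fin cosh_ge0.
pose e' := e / (2 * l + 1).
have l1 : 0 < 2 * l + 1 by rewrite ltr_pwDr ?mulr_ge0.
have e'0 : 0 < e' by rewrite divr_gt0.
have le' : 2 * l * e' <= e.
  by rewrite /e' mulrCA ger_pMr// ler_pdivrMr//; lra.
pose C := seqDU (fun i => ball (a i) e').
have GC i : G (f @^-1` C i).
  apply: Gf; apply: (@measurableD _ (g_sigma_algebraType (@open X))).
    by apply: sub_sigma_algebra; exact: ball_open.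
  apply: bigsetU_measurable => k _.
  by apply: sub_sigma_algebra; exact: ball_open.
pose B i := A `&` f @^-1` C i.
have GB i : G (B i) by exact: sigma_algebra_setI.
have AB : A = \bigcup_i B i.
  apply/seteqP; split => [w Aw|w [i _ []]//].
  have [i fi] := aP (f w) e' e'0.
  have : (\bigcup_i ball (a i) e') (f w).
    by exists i => //; rewrite -ball_normE/= distrC.
  by rewrite seqDU_bigcup_eq => -[k _ Ck]; exists k.
have tB : trivIset setT B.
  apply: trivIset_setIl => i j _ _ [w [Ci Cj]].
  apply: (@trivIset_seqDU _ (fun i => ball (a i) e') i j Logic.I Logic.I).
  by exists (f w).
have mB i : measurable (B i) by exact: mG (GB i).
have H0 u : (0 <= (cosh u)%:E :> \bar R)%E by rewrite lee_fin cosh_ge0.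
rewrite AB !ge0_integral_bigcup//; last 2 first.
- exact: measurable_cosh_norm (norm_measurable_segment _ _ t sepX mf mg).
- exact: measurable_cosh_norm mf.
rewrite -nneseriesZl; last by move=> i _; rewrite integral_ge0.
apply: lee_nneseries => [i _ _|i _]; first by rewrite integral_ge0.
apply: (le_trans (jensen_cosh_cell (B i) (a i) e' t (GB i) (ltW e'0) _)).
  move=> w [_ [+ _]]; rewrite -ball_normE/= distrC; exact: ltW.
by rewrite lee_wpmul2r ?integral_ge0// lee_fin ler_expR.
Qed.

(** Along the segment from [f] to [g], the mean of [cosh (l * |.|)] satisfies the
    hypotheses of [cosh_ode_comparison]: the recurrence is the smoothness of the
    norm, minimality at [0] is Jensen's inequality. *)
Lemma cosh_one_step (D c : R) A : smooth2 X D -> 0 <= D -> 0 <= c ->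
  {ae P, forall w, `|g w - f w| <= c} -> G A ->
  (\int[P]_(w in A) (cosh (l * `|g w|))%:E <=
   (cosh (l * D * c))%:E * \int[P]_(w in A) (cosh (l * `|f w|))%:E)%E.
Proof.
move=> hsmooth D0 c0 gfc GA; have mA := mG _ GA.
have sm (t h : R) : {ae P, forall w,
    cosh (l * `|f w + (t + h) *: (g w - f w)|) +
    cosh (l * `|f w + (t - h) *: (g w - f w)|) <=
    2 * cosh (l * D * c * h) * cosh (l * `|f w + t *: (g w - f w)|)}.
  apply: filterS gfc => w gfw.
  have -> : cosh (l * D * c * h) = cosh (l * D * (`|h| * c)).
    have [h0|h0] := ger0P h; first by congr cosh; ring.
    by rewrite -coshN; congr cosh; ring.
  rewrite [in X in X + _]scalerDl addrA scalerBl addrA.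
  by apply: smooth2_cosh => //; rewrite normrZ ler_wpM2l.
have {D0 c0} C0 : 0 <= l * D * c by rewrite !mulr_ge0.
clear hsmooth gfc.
pose phi t := (\int[P]_(w in A) (cosh (l * `|f w + t *: (g w - f w)|))%:E)%E.
have phi_ge0 t : (0 <= phi t)%E.
  by apply: integral_ge0 => w _; rewrite lee_fin cosh_ge0.
have phi0 : phi 0 = (\int[P]_(w in A) (cosh (l * `|f w|))%:E)%E.
  by apply: eq_integral => w _; rewrite scale0r addr0.
have phi1 : phi 1 = (\int[P]_(w in A) (cosh (l * `|g w|))%:E)%E.
  by apply: eq_integral => w _; rewrite scale1r subrKC.
have jen (t : R) : (phi 0%R <= phi t)%E by rewrite phi0; exact: jensen_cosh.
rewrite -{}phi0 -{}phi1.
have mphi t : measurable_fun A (fun w =>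
    (cosh (l * `|f w + t *: (g w - f w)|))%:E).
    exact: measurable_cosh_norm (norm_measurable_segment _ _ t sepX mf mg).
have rec (t h : R) : (phi (t + h)%R + phi (t - h)%R <=
    (2 * cosh (l * D * c * h))%:E * phi t)%E.
  have K0 : 0 <= 2 * cosh (l * D * c * h) by rewrite mulr_ge0 ?cosh_ge0.
  rewrite /phi -ge0_integralD//.
  - rewrite -ge0_integralZl//; last by move=> w _; rewrite lee_fin cosh_ge0.
    apply: ae_ge0_le_integral => //.
    + by move=> w _; rewrite -EFinD lee_fin addr_ge0 ?cosh_ge0.
    + exact: emeasurable_funD.
    + by move=> w _; rewrite -EFinM lee_fin mulr_ge0 ?cosh_ge0.
    + exact: measurable_funeM.
    by apply: filterS (sm t h) => w smw _; rewrite -EFinD -EFinM lee_fin.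
  - by move=> w _; rewrite lee_fin cosh_ge0.
  - by move=> w _; rewrite lee_fin cosh_ge0.
have [phioo|phifin] := eqVneq (phi 0) +oo%E.
  by rewrite phioo gt0_muley ?leey// lte_fin cosh_gt0.
have fin0 : phi 0 \is a fin_num by rewrite ge0_fin_numE// lt_neqAle phifin leey.
(* the recurrence at [0] bounds [phi t + phi (- t)] by a multiple of [phi 0] *)
have fin t : phi t \is a fin_num.
  rewrite ge0_fin_numE//.
  apply: (@le_lt_trans _ _ (phi (0 + t)%R + phi (0 - t)%R)%E).
    by rewrite add0r leeDl.
  by apply: le_lt_trans (rec 0 t) _; rewrite ltey_eq fin_numM.
have [psi psiE] : exists psi : R -> R, forall t, phi t = (psi t)%:E.
  by exists (fine \o phi) => t; rewrite /= fineK.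
clearbody phi; rewrite !psiE -EFinM lee_fin; apply: cosh_ode_comparison => //.
- by rewrite -lee_fin -psiE.
- by move=> t h; rewrite -lee_fin EFinD EFinM -!psiE.
- by move=> h; rewrite -lee_fin -!psiE.
Qed.

End one_step.

(** * The tail bound *)

Lemma measurable_maximal d (T : measurableType d) (R : realType)
    (X : completeNormedModType R) (f : nat -> T -> X) :
  (forall n, norm_measurable (f n)) -> measurable_fun setT (maximal f).
Proof.
move=> mf.
have := @measurable_fun_esups d T R setT (fun n w => (`|f n w|)%:E) _ 0%N.
rewrite (_ : (fun w => _) = maximal f); first apply.
  by move=> n; apply/measurable_EFinP/norm_measurable_norm.
apply/funext => w; rewrite /esups/= /maximal; congr ereal_sup.
by rewrite /sdrop; apply/seteqP; split => x [k _ <-]; exists k.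
Qed.

Section martingale.
Context {d : measure_display} {T : measurableType d} {R : realType}.
Context {P : probability T R} {X : completeNormedModType R}.
Variables (D : R) (D0 : 0 <= D) (sepX : separable X) (hsmooth : smooth2 X D).
Variables (F : nat -> set (set T)) (f : nat -> T -> X).
Hypotheses (hf : martingale P F f) (hf0 : forall w, f 0%N w = 0).

Lemma norm_ge_in_filtration (x : R) k : F k [set w | x <= `|f k w|].
Proof.
have [_ bF _ _] := hf.
have -> : [set w | x <= `|f k w|] = f k @^-1` (~` ball 0 x).
  apply/seteqP; split => w /=; rewrite -ball_normE/= sub0r normrN.
    by move=> xf; apply/negP; rewrite -leNgt.
  by move/negP; rewrite -leNgt.
by apply: bF; apply: sigma_algebraC; apply: sub_sigma_algebra; exact: ball_open.
Qed.

(** The process [exp (- l^2 D^2 S_k / 2) * cosh (l * |f k|)], with [S_k] the sum of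
    the first [k] values [c i ^+ 2], is a supermartingale starting at [1]. *)
Lemma norm_tail_bound (c : nat -> R) (b l x : R) : 0 <= l ->
  (forall n, 0 <= c n) ->
  (forall n, {ae P, forall w, `|f n.+1 w - f n w| <= c n}) ->
  (forall n, \sum_(i < n) c i ^+ 2 <= b ^+ 2) ->
  (P (\bigcup_k [set w | (x <= `|f k w|)%R]) <=
   (2 * expR (- (l * x) + (l * D * b) ^+ 2 / 2))%:E)%E.
Proof.
move=> l0 c0 fc cb; have [FF bF bfi cond] := hf.
have [sF mF _] := FF.
pose W k := expR (- ((l * D) ^+ 2 * (\sum_(i < k) c i ^+ 2) / 2)).
have W0 k : 0 <= W k by exact: expR_ge0.
pose Y k w := ((W k)%:E * (cosh (l * `|f k w|))%:E)%E.
have mcosh k A : measurable_fun A (fun w => (cosh (l * `|f k w|))%:E).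
  by apply: measurable_cosh_norm; exact: borel_norm_measurable (bfi k).1.
have WS k : W k.+1 * cosh (l * D * c k) <= W k.
  apply: (@le_trans _ _ (W k.+1 * expR ((l * D * c k) ^+ 2 / 2))).
    by rewrite ler_wpM2l// cosh_le_expR_sqr.
  rewrite -expRD big_ord_recr/= ler_expR le_eqVlt; apply/orP; left; apply/eqP.
  by field.
(* [expR u / 2] instead of [cosh u], so that [x] may be negative *)
pose y := expR (l * x - (l * D * b) ^+ 2 / 2) / 2.
have y0 : 0 < y by rewrite divr_gt0 ?expR_gt0.
have : (y%:E * P (\bigcup_k [set w | (x <= `|f k w|)%R]) <=
    \int[P]_w Y 0%N w)%E.
  apply: (@supermartingale_maximal _ _ _ _ F) => //.
  - exact: ltW.
  - by move=> k w; rewrite /Y -EFinM lee_fin mulr_ge0 ?cosh_ge0.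
  - by move=> k; apply: measurable_funeM; exact: mcosh.
  - move=> k A FA; have mA := mF k A FA.
    rewrite /Y !ge0_integralZl ?lee_fin//.
    + have [_ _ ck] := cond k.
      have ck' B : F k B ->
          bochner_integral P B (f k.+1) = bochner_integral P B (f k).
        by move=> FB; rewrite ck.
      have os := cosh_one_step sepX (F k) _ _ (sF k) (mF k) (bF k) (bfi k)
        (bfi k.+1) ck' l l0 D (c k) A hsmooth D0 (c0 k) (fc k) FA.
      apply: (le_trans (lee_wpmul2l _ os)); first by rewrite lee_fin.
      rewrite muleA -EFinM lee_wpmul2r ?lee_fin// integral_ge0// => w _.
      by rewrite lee_fin cosh_ge0.
    + by move=> w _; rewrite lee_fin cosh_ge0.
    + by move=> w _; rewrite lee_fin cosh_ge0.
  - by move=> k; exact: norm_ge_in_filtration.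
  - move=> k w /= xw; rewrite /Y -EFinM lee_fin.
    have h1 : expR (- ((l * D * b) ^+ 2 / 2)) <= W k.
      by rewrite ler_expR lerN2 ler_wpM2r// [leRHS]exprMn ler_wpM2l ?sqr_ge0.
    have h2 : expR (l * x) / 2 <= cosh (l * `|f k w|).
      rewrite ler_pdivrMr// [leRHS]mulrC; apply: le_trans (expR_le_cosh _).
      by rewrite ler_expR ler_wpM2l.
    by rewrite /y expRD mulrAC mulrC ler_pM ?divr_ge0 ?expR_ge0.
have -> : (\int[P]_w Y 0%N w = 1)%E.
  rewrite (eq_integral (cst 1%E)).
    by rewrite integral_cst// mul1e; exact: probability_setT.
  move=> w _; rewrite /Y hf0 normr0 mulr0 cosh0 mule1 /W big_ord0.
  by rewrite mulr0 mul0r oppr0 expR0.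
rewrite -lee_pdivlMl// => /le_trans; apply.
rewrite mule1 lee_fin /y invf_div -expRN opprB addrC le_eqVlt.
by rewrite [- _ + _]addrC eqxx.
Qed.

End martingale.

Theorem theorem3p5 (R : realType) (D : R) (hD : 0 < D)
    (X : completeNormedModType R) (hX : separable X) (hsmooth : smooth2 X D)
    (d : measure_display) (T : measurableType d) (P : probability T R)
    (F : nat -> set (set T)) (f : nat -> T -> X)
    (hf : martingale P F f) (hf0 : forall w, f 0%N w = 0)
    (b : R) (hb : 0 < b)
    (hdiff : (\sum_(1 <= j <oo) norm_infty P (mart_diff f j) ^+ 2
              <= (b ^+ 2)%:E)%E)
    (r : R) (hr : 0 <= r) :
  (P [set w | r%:E <= maximal f w]
   <= (2 * expR (- (r ^+ 2 / (2 * D ^+ 2 * b ^+ 2))))%:E)%E.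
Proof.
have mf n : norm_measurable (f n).
  by have [_ _ bfi _] := hf; exact: borel_norm_measurable (bfi n).1.
pose N j := norm_infty P (mart_diff f j).
have N0 j : (0 <= N j)%E.
  apply: ess_sup_gee; first by rewrite [ltRHS](probability_setT P) lte01.
  by apply: nearW => w; rewrite lee_fin.
have sumN n : (\sum_(i < n) N i.+1 ^+ 2 <= (b ^+ 2)%:E)%E.
  apply: le_trans hdiff.
  have := @nneseries_lim_ge R (fun j => (N j ^+ 2)%E) xpredT 1 n.+1.
  rewrite big_add1/= big_mkord; apply => k _ _; exact: sqre_ge0.
have Nb j : (N j.+1 <= b%:E)%E.
  rewrite -(@lee_sqr R) ?lee_fin ?(ltW hb)// -EFin_expe.
  apply: le_trans (sumN j.+1); rewrite big_ord_recr/= leeDr// sume_ge0// => i _.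
  exact: sqre_ge0.
have Nfin j : N j.+1 \is a fin_num.
  by rewrite ge0_fin_numE// (le_lt_trans (Nb j))// ltry.
pose c j := fine (N j.+1).
have c0 j : 0 <= c j by rewrite fine_ge0.
have cb n : \sum_(i < n) c i ^+ 2 <= b ^+ 2.
  rewrite -lee_fin (le_trans _ (sumN n))// -sumEFin; apply: lee_sum => i _.
  by rewrite EFin_expe fineK.
have fc n : {ae P, forall w, `|f n.+1 w - f n w| <= c n}.
  apply: filterS (ess_sup_ge P (fun w => (`|mart_diff f n.+1 w|)%:E)) => w.
  by rewrite -/(norm_infty P _) -/(N n.+1) -(fineK (Nfin n)) lee_fin.
have Db0 : 0 < D ^+ 2 * b ^+ 2 by rewrite mulr_gt0 ?exprn_gt0.
(* the minimizer of [l |-> - l * r + (l * D * b) ^+ 2 / 2] *)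
pose l := r / (D ^+ 2 * b ^+ 2).
have l0 : 0 <= l by rewrite divr_ge0// ltW.
have expE : - (l * r) + (l * D * b) ^+ 2 / 2 =
    - (r ^+ 2 / (2 * D ^+ 2 * b ^+ 2)).
  by rewrite /l; field; rewrite !gt_eqF.
have mE x : measurable (\bigcup_k [set w | x <= `|f k w|]).
  apply: bigcupT_measurable => k; have [[_ mF _] _ _ _] := hf.
  exact: mF _ (norm_ge_in_filtration _ _ hf x k).
have mmax : measurable [set w | (r%:E <= maximal f w)%E].
  rewrite -[X in measurable X]setTI.
  exact: emeasurable_fun_c_infty (measurable_maximal _ _ _ _ _ mf) _.
apply: lee_expR_mul => [|e e0]; first by rewrite lee_fin mulr_ge0 ?expR_ge0.
(* the supremum may not be attained, so the level is lowered slightly *)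
pose x := r - e / (l + 1).
have l1 : 0 < l + 1 by lra.
have xr : x < r by rewrite gtrBl divr_gt0.
apply: (@le_trans _ _ (P (\bigcup_k [set w | (x <= `|f k w|)%R]))).
  apply: le_measure; rewrite ?inE// => w /= rw.
  have : (x%:E < maximal f w)%E by rewrite (lt_le_trans _ rw)// lte_fin.
  by move=> /ereal_sup_gt[_ [k _ <-]]; rewrite lte_fin => /ltW xk; exists k.
apply: (le_trans (norm_tail_bound D (ltW hD) hX hsmooth F f hf hf0 c b l x
  l0 c0 fc cb)).
rewrite -EFinM lee_fin mulrCA ler_wpM2l// -expE -expRD ler_expR addrA lerD2r.
rewrite /x mulrBr opprB lerD2r mulrA ler_pdivrMr// mulrC ler_wpM2l ?ltW//; lra.
Qed.
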